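(* Let $S$ be a non-lattice shift of finite type on $\mathbb{Z}$. There exist an integer $k$ (depending on $S$) and a stationary $k$-dependent process $X=(X_i)_{i\in\mathbb{Z}}$ such that the random sequence $X$ belongs to $S$ almost surely.
   Context: Write $[q]=\{1,\ldots,q\}$. A shift of finite type on $\mathbb{Z}$ is a set of sequences of the form $$S=S(q,m,W)=\bigl\{x\in[q]^{\mathbb{Z}}:(x_{i+1},\ldots,x_{i+m})\in W\ \ \forall i\in\mathbb{Z}\bigr\},$$ for positive integers $q,m$ and a set $W\subseteq[q]^m$. For $w\in W$, let $T(w)$ be the set of $t\ge 1$ for which there exists $x\in S$ with $(x_1,\ldots,x_m)$ and $(x_{t+1},\ldots,x_{t+m})$ both equal to $w$. The shift of finite type is called non-lattice if there exists $w\in W$ for which $T(w)$ has greatest common divisor $1$. A stochastic process $X=(X_i)_{i\in\mathbb{Z}}$ is $k$-dependent if the random sequences $(\ldots,X_{i-2},X_{i-1})$ and $(X_{i+k},X_{i+k+1},\ldots)$ are independent of each other, for each $i\in\mathbb{Z}$. It is stationary if $(X_i)_{i\in\mathbb{Z}}$ and $(X_{i+1})_{i\in\mathbb{Z}}$ are equal in law. *)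

(* Defs.v *)
From mathcomp Require Import all_boot all_order all_algebra.
From mathcomp Require Import boolp classical_sets reals ereal measure.

Set Implicit Arguments.
Unset Strict Implicit.
Unset Printing Implicit Defensive.

Import Order.TTheory GRing.Theory Num.Theory.

Local Open Scope classical_set_scope.
Local Open Scope ring_scope.

(* The alphabet [q] = {1, ..., q} is represented by 'I_q = {0, ..., q - 1}. *)

(* (x_{i+1}, ..., x_{i+m}); j ranges over 0, ..., m - 1. *)
Definition word (q m : nat) (x : int -> 'I_q) (i : int) : m.-tuple 'I_q :=
  [tuple x (i + j.+1%:Z) | j < m].

Definition SFT (q m : nat) (W : {set m.-tuple 'I_q}) : set (int -> 'I_q) :=
  [set x | forall i : int, word m x i \in W].

Definition return_times (q m : nat) (W : {set m.-tuple 'I_q})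
    (w : m.-tuple 'I_q) : set nat :=
  [set t | (1 <= t)%N /\
     exists x, [/\ SFT W x, word m x 0 = w & word m x t%:Z = w]].

(* The gcd of the empty set is 0 with this convention. *)
Definition is_gcd (A : set nat) (g : nat) : Prop :=
  (forall t, A t -> (g %| t)%N) /\
  (forall d, (forall t, A t -> (d %| t)%N) -> (d %| g)%N).

Definition non_lattice (q m : nat) (W : {set m.-tuple 'I_q}) : Prop :=
  exists2 w, w \in W & is_gcd (return_times W w) 1.

(* The sigma-algebra generated by the maps f j, j in J, where 'I_q carries the
   discrete sigma-algebra. *)
Definition generated_sigma (T : Type) (q : nat) (f : int -> T -> 'I_q)
    (J : set int) : set (set T) :=
  <<s \bigcup_(j in J) preimage_set_system setT (f j) [set: set 'I_q] >>.

(* The product sigma-algebra on sequences, generated by the coordinates. *)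
Definition sequence_sigma (q : nat) : set (set (int -> 'I_q)) :=
  generated_sigma (fun (i : int) (x : int -> 'I_q) => x i) setT.

Section Processes.
Context (d : measure_display) (T : measurableType d) (R : realType).
Context (P : probability T R) (q : nat).
Implicit Types X Y : int -> T -> 'I_q.

Definition is_process X : Prop :=
  forall (i : int) (A : set 'I_q), measurable (X i @^-1` A).

Definition same_law X Y : Prop :=
  forall B, sequence_sigma B -> P [set o | B (X^~ o)] = P [set o | B (Y^~ o)].

Definition stationary X : Prop := same_law X (fun i => X (i + 1)).

Definition k_dependent (k : nat) X : Prop :=
  forall (i : int) (A B : set T),
    generated_sigma X [set j | j < i] A ->
    generated_sigma X [set j | i + k%:Z <= j] B ->
    P (A `&` B) = (P A * P B)%E.

End Processes.

(* Main.v *)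
From HB Require Import structures.
Require Import Defs.
From mathcomp Require Import all_boot all_order all_algebra.
From mathcomp Require Import boolp classical_sets functions cardinality fsbigop.
From mathcomp Require Import reals ereal measure lebesgue_measure.
From mathcomp Require Import interval_inference ring zify.

(** Fix a word [w] whose return times have gcd 1.  Return times are closed under
    addition, because two orbits can be glued at an occurrence of [w]; so [w]
    returns after every sufficiently large time [g], along some point
    [loop g] of the shift ([return_times_large]).  Suppose that a random set of
    markers in the integers is given whose gaps all lie in [n+1 .. 2n+1], with
    [n] large.  Between two markers at distance [g], write the letters
    [1 .. g] of [loop g].  Since [w] starts right after every marker and gaps
    exceed [m], every window of length [m] reads a word of a single [loop g],
    hence an allowed word ([fill_SFT]).  It remains to find a stationary,
    finitely dependent set of markers.

    Markers come from a range-[n] colouring, one in which any two letters at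
    distance at most [n] differ: going through the colours one by one and
    greedily marking the sites with no marker within distance [n] gives a
    maximal [n]-separated set, and this is decided by a bounded neighbourhood of
    each site ([mark_separated], [marked_dense], [mark_local]).  So the final
    sequence is a block factor of the colouring, and block factors preserve
    stationarity and finite dependence ([block_factor_process]).

    A block factor of an i.i.d. sequence cannot be a proper colouring, so the
    source of the construction is the one-dependent 4-colouring of Holroyd and
    Liggett.  The weight of a proper word of length [k > 0] is the sum of the
    weights of its one-letter deletions divided by [2 (k + 1)], and the whole
    content of the construction is the identity
      sum over a of weight (x a y)  =  weight x * weight y,
    proved by induction on the two lengths ([weight_sumE]); with an empty [x] or
    [y] it says that the weights are consistent, and in general that they are
    1-dependent.  A proper colouring alone does not give long gaps (the stretch
    1212... is 2-periodic, and so is any block factor of it), so it is upgraded: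
    colouring the [s] residue classes mod [s] by independent copies separates
    sites at distance exactly [s] and keeps stationarity ([interleave_law]),
    and doing so independently for [s = 1 .. n] separates all distances up to
    [n] ([range_law], [range_weight_eq0]).

    All of this happens on finite words.  The passage to an actual process codes
    finite words by nested subintervals of the unit interval whose lengths are
    the weights, extending the word alternately to the right and to the left
    ([stateP], [coordinate_process]).  The statements about sigma-algebras
    follow from those about windows by the pi-lambda theorem. *)

Set Implicit Arguments.
Unset Strict Implicit.
Unset Printing Implicit Defensive.

Import Order.TTheory GRing.Theory Num.Theory.
Local Open Scope classical_set_scope.
Local Open Scope ring_scope.

(** * Weights of words *)

Section WordSums.
Context (R : realFieldType) (A : finType).
Implicit Types (f g : seq A -> R) (p : seq A -> R) (u v w : seq A).

Fixpoint sum_words n f : R :=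
  if n is n'.+1 then \sum_a sum_words n' (fun u => f (a :: u)) else f [::].

Lemma eq_sum_words n f g :
  (forall u, size u = n -> f u = g u) -> sum_words n f = sum_words n g.
Proof.
elim: n f g => [|n IH] f g fg /=; first exact: fg.
by apply: eq_bigr => a _; apply: IH => u su; apply: fg; rewrite /= su.
Qed.

Lemma sum_words_cat m n f :
  sum_words (m + n) f =
  sum_words m (fun u => sum_words n (fun v => f (u ++ v))).
Proof. by elim: m f => //= m IH f; apply: eq_bigr => a _; rewrite IH. Qed.

Lemma sum_words_mull n c f :
  sum_words n (fun u => c * f u) = c * sum_words n f.
Proof.
elim: n f => //= n IH f; rewrite mulr_sumr.
by apply: eq_bigr => a _; rewrite IH.
Qed.

Lemma sum_words_mulr n c f :
  sum_words n (fun u => f u * c) = sum_words n f * c.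
Proof.
by rewrite mulrC -sum_words_mull; apply: eq_sum_words => u _; rewrite mulrC.
Qed.

Lemma exchange_sum_words m n (h : seq A -> seq A -> R) :
  sum_words m (fun u => sum_words n (h u)) =
  sum_words n (fun v => sum_words m (h^~ v)).
Proof.
have sum1 k (e : A -> seq A -> R) :
    \sum_a sum_words k (e a) = sum_words k (fun u => \sum_a e a u).
  elim: k e => //= k IH e; rewrite exchange_big /=.
  by apply: eq_bigr => b _; rewrite (IH (fun a u => e a (b :: u))).
elim: m h => //= m IH h; rewrite -sum1.
by apply: eq_bigr => a _; rewrite (IH (fun u => h (a :: u))).
Qed.

Lemma sum_words_ge0 n f : (forall u, 0 <= f u) -> 0 <= sum_words n f.
Proof. by elim: n f => //= n IH f f0; apply: sumr_ge0 => a _; apply: IH. Qed.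

Lemma sum_wordsE n f : sum_words n f = \sum_(t : n.-tuple A) f t.
Proof.
elim: n f => [|n IH] f /=.
  rewrite (big_pred1 [tuple]) // => t /=; apply/esym/eqP; exact: tuple0.
under eq_bigr do rewrite IH.
rewrite pair_big /=.
rewrite (reindex (fun t : n.+1.-tuple A => (thead t, [tuple of behead t]))) /=.
  by apply: eq_bigr => t _; rewrite [in RHS](tuple_eta t).
exists (fun x : A * n.-tuple A => [tuple of x.1 :: x.2]) => [t _|[a t] _] /=.
  exact/esym/tuple_eta.
by rewrite theadE; congr (_, _); apply: val_inj.
Qed.

(** The finite-dimensional marginals of a stationary [k]-dependent process:
    [p u] is the probability of reading [u] on any given interval. *)
Record word_law k p : Prop := WordLaw {
  law_ge0 : forall u, 0 <= p u;
  law_nil : p [::] = 1;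
  law_cons : forall u, \sum_a p (a :: u) = p u;
  law_rcons : forall u, \sum_a p (rcons u a) = p u;
  law_indep : forall u v, sum_words k (fun w => p (u ++ w ++ v)) = p u * p v
}.

Section Theory.
Context k p (lp : word_law k p).

Lemma law_sum_left n u : sum_words n (fun w => p (w ++ u)) = p u.
Proof.
elim: n u => //= n IH u; rewrite -[RHS]IH.
apply: (etrans (exchange_sum_words 1 n (fun a w => p (a ++ w ++ u)))).
by apply: eq_sum_words => w _; exact: (law_cons lp).
Qed.

Lemma law_sum_right n u : sum_words n (fun w => p (u ++ w)) = p u.
Proof.
elim: n u => [|n IH] u /=; first by rewrite cats0.
rewrite -[RHS](law_rcons lp); apply: eq_bigr => a _.
by rewrite -(IH (rcons u a)); apply: eq_sum_words => w _; rewrite cat_rcons.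
Qed.

(** Independence survives a larger gap: the extra letters are summed out by
    consistency on the right. *)
Lemma law_indep_le n u v : (k <= n)%N ->
  sum_words n (fun w => p (u ++ w ++ v)) = p u * p v.
Proof.
move=> /subnK <-; rewrite sum_words_cat -[p u](law_sum_right (n - k)).
rewrite -sum_words_mulr; apply: eq_sum_words => w _.
by rewrite -(law_indep lp); apply: eq_sum_words => w' _; rewrite -!catA.
Qed.

Lemma word_law_le k' : (k <= k')%N -> word_law k' p.
Proof. by move=> kk'; case: (lp) => *; split=> // u v; exact: law_indep_le. Qed.

(** A word containing a null word is null, as it is one term of a sum of
    nonnegative terms that equals the weight of the smaller word. *)
Lemma law_infix u v w : p v = 0 -> p (u ++ v ++ w) = 0.
Proof.
have mono n (f : seq A -> R) x :
    (forall y, 0 <= f y) -> size x = n -> f x <= sum_words n f.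
  move=> f0; elim: n f f0 x => [|n IH] f f0 [|a x] //= [sx].
  rewrite (bigD1 a) //= ler_wpDr ?sumr_ge0 //.
    by move=> b _; apply: sum_words_ge0.
  exact: (IH (fun u => f (a :: u))).
move=> pv0.
have pvw : p (v ++ w) = 0.
  apply/eqP; rewrite eq_le (law_ge0 lp) andbT -pv0.
  rewrite -[leRHS](law_sum_right (size w)).
  by apply: (mono _ (fun w => p (v ++ w))) => // y; exact: (law_ge0 lp).
apply/eqP; rewrite eq_le (law_ge0 lp) andbT -pvw.
rewrite -[leRHS](law_sum_left (size u)).
by apply: (mono _ (fun u => p (u ++ v ++ w))) => // y; exact: (law_ge0 lp).
Qed.

End Theory.
End WordSums.

Section Coloring.
Context (R : realFieldType).
Implicit Types (x y u w : seq 'I_4).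

Definition proper_word u := sorted (fun a b => a != b) u.

Fixpoint deletions u : seq (seq 'I_4) :=
  if u is a :: u' then u' :: map (cons a) (deletions u') else [::].

(** The Holroyd-Liggett weight.  Up to normalization it counts the ways to build
    the word by inserting its letters one at a time, all intermediate words
    being proper. *)
Fixpoint weight_rec n u : R :=
  if n is n'.+1 then
    if proper_word u
    then (\sum_(w <- deletions u) weight_rec n' w) / (2 * n.+1)%:R
    else 0
  else 1.

Definition weight u := weight_rec (size u) u.

Lemma size_deletions u w : w \in deletions u -> (size w).+1 = size u.
Proof.
elim: u w => //= a u IH w; rewrite inE => /predU1P[-> //|/mapP[v vu ->]] /=.
by rewrite IH.
Qed.

Lemma weightE u : u != [::] ->
  weight u =
  (proper_word u)%:R * (\sum_(w <- deletions u) weight w) /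
    (2 * (size u).+1)%:R.
Proof.
case: u => // a u _; rewrite {1}/weight /=.
case: (path _ a u); last by rewrite mulr0n !mul0r.
rewrite mulr1n mul1r; congr (_ / _); apply: eq_big_seq => w wu.
by have /= [<-] := @size_deletions (a :: u) w wu.
Qed.

Lemma weight_improper u : ~~ proper_word u -> weight u = 0.
Proof.
move=> pu; rewrite weightE; first by rewrite (negbTE pu) mulr0n !mul0r.
by apply: contraNneq pu => ->.
Qed.

Lemma weight_nil : weight [::] = 1. Proof. by []. Qed.

Lemma weight_ge0 u : 0 <= weight u.
Proof.
rewrite /weight; move: (size u) => n.
elim: n u => //= n IH u; case: ifP => // _.
by rewrite divr_ge0 // sumr_ge0.
Qed.

Lemma deletions_cat x y :
  deletions (x ++ y) = [seq w ++ y | w <- deletions x] ++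
                       [seq x ++ w | w <- deletions y].
Proof.
elim: x => [|a x IH] /=; first by rewrite map_id.
by rewrite IH map_cat -!map_comp.
Qed.

Lemma deletions_rcons x c :
  deletions (rcons x c) = rcons [seq rcons w c | w <- deletions x] x.
Proof.
rewrite -cats1 deletions_cat /= -cats1 cats0; congr (_ ++ _).
by apply: eq_map => w; rewrite cats1.
Qed.

Lemma proper_word_cat x a y :
  proper_word (x ++ a :: y) = proper_word (rcons x a) && proper_word (a :: y).
Proof. by case: x => //= b x; rewrite cat_path rcons_path /= andbA. Qed.

Lemma proper_word_rcons2 x c a : proper_word (rcons (rcons x c) a) =
  proper_word (rcons x c) && (c != a).
Proof. by case: x => [|b x] /=; rewrite ?andbT // !rcons_path last_rcons. Qed.

Lemma proper_word_suffix x y : proper_word (x ++ y) -> proper_word y.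
Proof. by case: y => // a y; rewrite proper_word_cat => /andP[]. Qed.

Lemma proper_word_prefix x y : proper_word (x ++ y) -> proper_word x.
Proof. by case: x => //= a x; rewrite cat_path => /andP[]. Qed.

Definition weight_sum x y := \sum_a weight (x ++ a :: y).

Lemma sum_delta (c : 'I_4) (r : R) : \sum_a (a == c)%:R * r = r.
Proof.
rewrite (bigD1 c) //= eqxx mul1r big1 ?addr0 // => a /negbTE ->.
by rewrite mul0r.
Qed.

(** Summing over all [a] instead of the proper insertions only adds terms that
    vanish, except one: deleting the last letter [c] of the left word and
    inserting [a = c] restores that word. *)
Lemma left_deletions x c y : proper_word (rcons x c) -> proper_word y ->
  \sum_a (proper_word (rcons x c ++ a :: y))%:R *
     \sum_(w <- deletions (rcons x c)) weight (w ++ a :: y) =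
  \sum_(w <- deletions (rcons x c)) weight_sum w y - weight (rcons x c ++ y).
Proof.
move=> px py; rewrite -(sum_delta c (weight _)) /weight_sum exchange_big /=.
rewrite -sumrB; apply: eq_bigr => a _.
have [ok|nok] := boolP (proper_word _).
  rewrite mul1r; move: ok; rewrite proper_word_cat proper_word_rcons2 eq_sym.
  by move=> /andP[/andP[_ /negbTE ->] _]; rewrite mul0r subr0.
rewrite mul0r deletions_rcons -cats1 big_cat /= big_map big_seq1.
rewrite big1_seq ?add0r.
  have [->|ac] := eqVneq a c; first by rewrite mul1r cat_rcons subrr.
  rewrite mul0r subr0 weight_improper //; apply: contra nok.
  move=> /proper_word_suffix py'.
  by rewrite proper_word_cat proper_word_rcons2 px py' eq_sym ac.
move=> w _; apply: weight_improper; apply: contra nok.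
by rewrite !proper_word_cat !proper_word_rcons2 px => /andP[/andP[_ ->] ->].
Qed.

(** The mirror image of [left_deletions]; here the exceptional term deletes the
    first letter of the right word. *)
Lemma right_deletions x c y : proper_word x -> proper_word (c :: y) ->
  \sum_a (proper_word (x ++ a :: c :: y))%:R *
     \sum_(w <- deletions (c :: y)) weight (x ++ a :: w) =
  \sum_(w <- deletions (c :: y)) weight_sum x w - weight (x ++ c :: y).
Proof.
move=> px py; rewrite -(sum_delta c (weight _)) /weight_sum exchange_big.
rewrite -sumrB; apply: eq_bigr => a _.
have [ok|nok] := boolP (proper_word _).
  rewrite mul1r; move: ok; rewrite proper_word_cat.
  by move=> /andP[_ /andP[/negbTE -> _]]; rewrite mul0r subr0.
rewrite mul0r [deletions _]/= big_cons big_map [X in _ + X - _]big1_seq ?addr0.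
  have [->|ac] := eqVneq a c; first by rewrite mul1r subrr.
  rewrite mul0r subr0 weight_improper //; apply: contra nok.
  by move: py; rewrite !proper_word_cat /= ac => -> /andP[-> _].
move=> w _; apply: weight_improper; apply: contra nok.
by move: py; rewrite !proper_word_cat /= => -> /and3P[-> -> _].
Qed.

(** If [x ++ y] is proper, its letters next to the insertion point are distinct,
    so each of them excludes a colour of its own. *)
Lemma card_insertions x y : proper_word x -> proper_word y ->
  \sum_a (proper_word (x ++ a :: y))%:R * weight (x ++ y) =
  (4 - (x != [::])%:R - (y != [::])%:R) * weight (x ++ y).
Proof.
move=> px py; have [pxy|/weight_improper ->] := boolP (proper_word (x ++ y));
  last first.
  by rewrite mulr0 big1 // => a _; rewrite mulr0.
rewrite -mulr_suml; congr (_ * _).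
case/lastP: x px pxy => [_ _|x c px].
  case: y py => [_|d y py].
    by rewrite sumr_const card_ord /= !subr0.
  rewrite (eq_bigr (fun a => 1 - (a == d)%:R)) => [|a _]; last first.
    by move: (py) => /= ->; rewrite andbT; case: eqP; rewrite ?subrr ?subr0.
  rewrite sumrB sumr_const card_ord (bigD1 d) //= eqxx big1 ?addr0 ?subr0 //.
  by move=> a /negbTE ->.
have -> : rcons x c != [::] by case: x {px}.
case: y py => [_ _|d y py].
  rewrite (eq_bigr (fun a => 1 - (a == c)%:R)) => [|a _]; last first.
    rewrite proper_word_cat proper_word_rcons2 px /= andbT eq_sym.
    by case: eqP; rewrite ?subrr ?subr0.
  rewrite sumrB sumr_const card_ord (bigD1 c) //= eqxx big1 ?addr0 ?subr0 //.
  by move=> a /negbTE ->.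
rewrite proper_word_cat proper_word_rcons2 px => /andP[/= cd _].
rewrite (eq_bigr (fun a => 1 - (a == c)%:R - (a == d)%:R)) => [|a _];
  last first.
  move: (py); rewrite proper_word_cat proper_word_rcons2 px /= => ->.
  rewrite andbT (eq_sym c).
  case: (eqVneq a c) => [->|_] /=; first by rewrite (negbTE cd) subrr subr0.
  by case: (a == d); rewrite /= subr0 ?subr0 ?subrr.
rewrite !sumrB sumr_const card_ord (bigD1 c) //= eqxx big1 ?addr0 =>
  [|a /negbTE -> //].
by rewrite (bigD1 d) //= eqxx big1 ?addr0 => [|a /negbTE -> //].
Qed.

(** The correction makes the recursion for [weight] valid for the empty word
    too. *)
Lemma sum_deletions_weight x : proper_word x ->
  \sum_(w <- deletions x) weight w + (2 * (x == [::]))%:R =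
  (2 * (size x).+1)%:R * weight x.
Proof.
have [->|x0] := eqVneq x [::]; first by rewrite big_nil weight_nil add0r mulr1.
move=> px; rewrite addr0 (weightE x0) px mul1r mulrC divfK //.
Qed.

(** Expand the weight of [x ++ a :: y] over its deletions.  Deleting [a] gives
    [weight (x ++ y)] once per admissible [a], that is twice when [x] and [y]
    are nonempty; this cancels the two exceptional terms of [left_deletions] and
    [right_deletions] exactly because there are four colours.  What is left is
    handled by induction, and the normalizations add up:
    [2 (|x| + 1) + 2 (|y| + 1) = 2 (|x ++ a :: y| + 1)]. *)
Lemma weight_sumE x y : weight_sum x y = weight x * weight y.
Proof.
have [n] := ubnP (size x + size y).
elim: n x y => // n IH x y; rewrite ltnS => sxy.
have [px|npx] := boolP (proper_word x); last first.
  rewrite (weight_improper npx) mul0r; apply: big1 => a _.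
  apply: weight_improper.
  by apply: contra npx => /proper_word_prefix.
have [py|npy] := boolP (proper_word y); last first.
  rewrite (weight_improper npy) mulr0; apply: big1 => a _.
  apply: weight_improper.
  by apply: contra npy; rewrite -cat_rcons => /proper_word_suffix.
have N0 : (2 * (size x + size y).+2)%:R != 0 :> R by rewrite pnatr_eq0.
apply: (mulfI N0).
have -> : (2 * (size x + size y).+2)%:R * weight_sum x y =
  \sum_a (proper_word (x ++ a :: y))%:R *
    \sum_(w <- deletions x) weight (w ++ a :: y) +
  \sum_a (proper_word (x ++ a :: y))%:R * weight (x ++ y) +
  \sum_a (proper_word (x ++ a :: y))%:R *
    \sum_(w <- deletions y) weight (x ++ a :: w).
  rewrite -!big_split /= mulr_sumr; apply: eq_bigr => a _.
  rewrite weightE ?size_cat /= ?addnS; last by case: (x).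
  rewrite mulrC divfK // deletions_cat big_cat /= big_cons !big_map.
  by rewrite -!mulrDr addrA.
have L : \sum_a (proper_word (x ++ a :: y))%:R *
      \sum_(w <- deletions x) weight (w ++ a :: y) =
    (\sum_(w <- deletions x) weight w) * weight y -
    (x != [::])%:R * weight (x ++ y).
  case/lastP: x px sxy {N0} => [_ _|x c px sxy].
    by rewrite !big_nil !mul0r subr0 big1 // => a _; rewrite big_nil mulr0.
  rewrite left_deletions // (_ : rcons x c != [::]) ?mul1r; last by case: (x).
  rewrite mulr_suml; congr (_ - _); apply: eq_big_seq => w /size_deletions sw.
  by apply: IH; lia.
have Rt : \sum_a (proper_word (x ++ a :: y))%:R *
      \sum_(w <- deletions y) weight (x ++ a :: w) =
    weight x * (\sum_(w <- deletions y) weight w) -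
    (y != [::])%:R * weight (x ++ y).
  case: y py sxy {N0 L} => [_ _|c y py sxy].
    by rewrite !big_nil mulr0 mul0r subr0 big1 // => a _; rewrite big_nil mulr0.
  rewrite right_deletions // mul1r.
  rewrite mulr_sumr; congr (_ - _); apply: eq_big_seq => w /size_deletions sw.
  by apply: IH; lia.
rewrite L card_insertions // Rt.
have := sum_deletions_weight px; have := sum_deletions_weight py.
have : (x == [::]) -> weight x = 1 /\ weight (x ++ y) = weight y.
  by move=> /eqP ->; rewrite weight_nil.
have : (y == [::]) -> weight y = 1 /\ weight (x ++ y) = weight x.
  by move=> /eqP ->; rewrite weight_nil cats0.
have -> : (2 * (size x + size y).+2)%:R =
    (2 * (size x).+1)%:R + (2 * (size y).+1)%:R :> R.
  by rewrite -natrD; congr _%:R; lia.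
move=> wy wx Ey Ex.
rewrite [RHS]mulrDl [X in _ = X + _]mulrA -Ex [X in _ = _ + X]mulrCA -Ey.
move: wx wy; case: (x == [::]); case: (y == [::]) => /=.
- by move=> /(_ isT)[-> ->] /(_ isT)[-> _]; ring.
- by move=> /(_ isT)[-> ->] _; ring.
- by move=> _ /(_ isT)[-> ->]; ring.
- by move=> _ _; ring.
Qed.

Lemma weight_law : word_law 1 weight.
Proof.
split.
- exact: weight_ge0.
- exact: weight_nil.
- by move=> u; rewrite -[RHS]mul1r -weight_nil -weight_sumE.
- move=> u; rewrite -[RHS]mulr1 -weight_nil -weight_sumE.
  by apply: eq_bigr => a _; rewrite cats1.
- by move=> u v; rewrite /= -weight_sumE.
Qed.

End Coloring.

(** * Independent and interleaved copies: forcing nearby letters apart *)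

Section Interleaving.
Context (R : realFieldType) (A : finType) (p : seq A -> R).
Implicit Types (L M X : seq (seq A)) (u v w : seq A).

(** Dealing: the letter is appended to the first stack, which then moves to the
    back.  After a whole word has been dealt to [s] stacks, each stack holds the
    letters of one residue class mod [s]. *)
Definition deal_letter L a := if L is h :: t then rcons t (rcons h a) else [::].

Definition deal L u := foldl deal_letter L u.

Definition stack_weight L := \prod_(w <- L) p w.

Definition interleave s u := stack_weight (deal (nseq s [::]) u).

Definition zipcat L M := [seq x.1 ++ x.2 | x <- zip L M].

Lemma size_deal_letter L a : size (deal_letter L a) = size L.
Proof. by case: L => //= h t; rewrite size_rcons. Qed.

Lemma size_deal L u : size (deal L u) = size L.
Proof. by elim: u L => //= a u IH L; rewrite IH size_deal_letter. Qed.

Lemma zipcat_rot1 L M : size L = size M ->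
  rot 1 (zipcat L M) = zipcat (rot 1 L) (rot 1 M).
Proof.
case: L M => [|l L] [|m M] // [LM].
by rewrite /zipcat /= !rot1_cons zip_rcons // map_rcons.
Qed.

Lemma deal_letter_zipcat L M a : size L = size M ->
  deal_letter (zipcat L M) a = zipcat (rot 1 L) (deal_letter M a).
Proof.
case: L M => [|l L] [|m M] // [LM].
by rewrite /zipcat /= rot1_cons zip_rcons // map_rcons rcons_cat.
Qed.

Lemma deal_zipcat L M u : size L = size M ->
  deal (zipcat L M) u = zipcat (iter (size u) (rot 1) L) (deal M u).
Proof.
elim: u L M => //= a u IH L M LM.
by rewrite deal_letter_zipcat // IH ?size_rot ?size_deal_letter // -iterSr.
Qed.

Lemma zipcat_nil L : zipcat L (nseq (size L) [::]) = L.
Proof.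
by elim: L => //= l L IH; rewrite /zipcat /= cats0 -/(zipcat _ _) IH.
Qed.

Lemma stack_weight_perm L M : perm_eq L M -> stack_weight L = stack_weight M.
Proof. exact: perm_big. Qed.

(** Dealing [v] on top of stacks [M] appends to each of them one of the stacks
    [X] that [v] alone produces.  The rotation that matches them up depends only
    on the length of [v], and the product does not see the order. *)
Lemma stack_weight_deal s v : exists X, [/\ size X = s,
  stack_weight X = interleave s v &
  forall M, size M = s -> stack_weight (deal M v) = stack_weight (zipcat M X)].
Proof.
exists (iter (size v) (rotr 1) (deal (nseq s [::]) v)).
set D := deal _ v; set n := size v.
have sD : size D = s by rewrite size_deal size_nseq.
have sX : size (iter n (rotr 1) D) = s.
  by elim: (n) => //= m IH; rewrite size_rotr.
split => //.
  apply: stack_weight_perm; elim: (n) => //= m IH.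
  by rewrite perm_rotr.
move=> M sM; rewrite -[in LHS](zipcat_nil M) deal_zipcat ?size_nseq //.
rewrite sM -/D -/n.
apply: stack_weight_perm.
elim: n M sM {sX} => //= n IH M sM.
rewrite -iterS iterSr; apply: (perm_trans (IH _ _)); first by rewrite size_rot.
set E := iter n _ D; have sE : size E = s.
  by rewrite /E; elim: (n) => //= m IHm; rewrite size_rotr.
by rewrite -{1}[E](rotrK 1) -zipcat_rot1 ?perm_rot // size_rotr sM.
Qed.

Lemma deal_round L M w : size w = size L ->
  deal (L ++ M) w = M ++ [seq rcons x.1 x.2 | x <- zip L w].
Proof.
elim: L M w => [|l L IH] M [|a w] //=; first by rewrite cats0.
by move=> [sw]; rewrite -cats1 -catA IH // cats1 cat_rcons.
Qed.

Context (lp : word_law 1 p).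

(** Summing over one full round of letters inserts exactly one free letter into
    each residue class, so 1-dependence applies class by class. *)
Lemma sum_round M X : size M = size X ->
  sum_words (size M) (fun w =>
    stack_weight (zipcat [seq rcons x.1 x.2 | x <- zip M w] X)) =
  stack_weight M * stack_weight X.
Proof.
rewrite /stack_weight; elim: M X => [|m M IH] [|x X] //=.
  by rewrite !big_nil mulr1.
move=> [sM]; rewrite !big_cons mulrACA -(IH X) // -(law_indep lp) /= mulr_suml.
apply: eq_bigr => a _; rewrite -sum_words_mull; apply: eq_sum_words => w _.
by rewrite big_cons cat_rcons.
Qed.

(** The law of [s] independent copies of a process, one for each residue class
    mod [s].  It is stationary because the copies have the same law, so that the
    product over the stacks does not depend on where the dealing starts. *)
Lemma interleave_law s : (0 < s)%N -> word_law s (interleave s).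
Proof.
move=> s0; split.
- by move=> u; apply: prodr_ge0 => w _; exact: law_ge0 lp _.
- by rewrite /interleave /stack_weight /= big_nseq (law_nil lp) iter_fix ?mulr1.
- move=> u; have [X [sX <- EX]] := stack_weight_deal s u.
  rewrite /interleave; case: s s0 sX EX => // s _.
  case/lastP: X => // X x; rewrite size_rcons => -[sX] EX.
  rewrite (eq_bigr (fun a => p (a :: x) * stack_weight X)) => [|a _];
    last first.
    rewrite -[deal _ _]/(deal (rcons (nseq s [::]) [:: a]) u).
    rewrite EX ?size_rcons ?size_nseq //.
    rewrite /zipcat zip_rcons ?size_nseq // map_rcons /stack_weight /= -cats1.
    rewrite big_cat big_seq1 /= mulrC; congr (_ * _); rewrite -sX.
    by elim: (X) => //= y Y IH; rewrite !big_cons IH.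
  rewrite -mulr_suml (law_cons lp) /stack_weight -cats1 big_cat big_seq1.
  by rewrite mulrC.
- move=> u; rewrite /interleave.
  have : (0 < size (deal (nseq s [::]) u))%N by rewrite size_deal size_nseq.
  rewrite /deal; under eq_bigr do rewrite -cats1 foldl_cat /=.
  case: (foldl _ _ _) => //= h t _.
  rewrite /stack_weight big_cons -(law_rcons lp) mulr_suml.
  by apply: eq_bigr => a _; rewrite -cats1 big_cat big_seq1 /= mulrC.
- move=> u v; have [X [sX EXv EX]] := stack_weight_deal s v.
  rewrite -EXv /interleave; set D := deal _ u.
  have sD : size D = s by rewrite size_deal size_nseq.
  rewrite -sum_round ?sX // sD; apply: eq_sum_words => w sw.
  rewrite /deal foldl_cat -/(deal _ u) foldl_cat -/(deal _ v) EX.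
    by rewrite -/D -[D]cats0 -/(deal _ w) deal_round ?cats0 ?sD.
  by rewrite -/(deal _ w) size_deal.
Qed.

(** Letters at distance [s.+1] are consecutive in their residue class. *)
Lemma interleave_eq0 s u v w a b :
  size v = s -> p [:: a; b] = 0 -> interleave s.+1 (u ++ a :: v ++ b :: w) = 0.
Proof.
move=> sv pab.
rewrite (_ : u ++ _ = u ++ (a :: v ++ [:: b]) ++ w); last by rewrite /= -catA.
apply: (law_infix (@interleave_law s.+1 isT)).
rewrite /interleave.
rewrite -[deal _ _]/(deal (rcons (nseq s [::]) [:: a]) (v ++ [:: b])).
rewrite /deal foldl_cat -/(deal _ v) -cats1 deal_round ?size_nseq //=.
by rewrite /stack_weight -cats1 big_cat big_seq1 /= pab mulr0.
Qed.

End Interleaving.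

Section Product.
Context (R : realFieldType) (A I : finType).

Definition product_weight (p : I -> seq A -> R) (u : seq {ffun I -> A}) : R :=
  \prod_i p i [seq c i | c : {ffun I -> A} <- u].

Lemma sum_words_product n (f : I -> seq A -> R) :
  sum_words n (product_weight f) = \prod_i sum_words n (f i).
Proof.
elim: n f => //= n IH f; rewrite bigA_distr_bigA /=; apply: eq_bigr => c _.
by rewrite -IH.
Qed.

Lemma product_law k (p : I -> seq A -> R) :
  (forall i, word_law k (p i)) -> word_law k (product_weight p).
Proof.
move=> lp; split.
- by move=> u; apply: prodr_ge0 => i _; exact: law_ge0 (lp i) _.
- by apply: big1 => i _; exact: law_nil (lp i).
- move=> u; transitivity
    (\prod_i \sum_a p i (a :: [seq c i | c : {ffun I -> A} <- u])).
    by rewrite bigA_distr_bigA.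
  by apply: eq_bigr => i _; exact: law_cons (lp i) _.
- move=> u; transitivity
    (\prod_i \sum_a p i (rcons [seq c i | c : {ffun I -> A} <- u] a)).
    rewrite bigA_distr_bigA; apply: eq_bigr => c _; apply: eq_bigr => i _.
    by rewrite map_rcons.
  by apply: eq_bigr => i _; exact: law_rcons (lp i) _.
- move=> u v; rewrite /product_weight -big_split /=.
  pose f i w := p i ([seq c i | c : {ffun I -> A} <- u] ++ w ++
                     [seq c i | c : {ffun I -> A} <- v]).
  rewrite (eq_sum_words (g := product_weight f)) => [|w _]; last first.
    by apply: eq_bigr => i _; rewrite !map_cat.
  rewrite sum_words_product; apply: eq_bigr => i _.
  exact: law_indep (lp i) _ _.
Qed.

End Product.

Section RangeColoring.
Context (R : realFieldType) (n : nat).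

(** Component [t] of a letter is a colouring that separates distance [t.+1]. *)
Definition range_weight : seq {ffun 'I_n -> 'I_4} -> R :=
  product_weight (fun t : 'I_n => interleave (@weight R) t.+1).

Lemma range_law : word_law n range_weight.
Proof.
apply: product_law => t.
have h := interleave_law (weight_law R) (ltn0Sn t).
exact: (word_law_le h (ltn_ord t)).
Qed.

Lemma range_weight_eq0 u v w c :
  (size v < n)%N -> range_weight (u ++ c :: v ++ c :: w) = 0.
Proof.
move=> sv; rewrite /range_weight /product_weight (bigD1 (Ordinal sv)) //=.
rewrite map_cat /= map_cat /= (interleave_eq0 (weight_law R)) ?mul0r //.
  by rewrite size_map.
by rewrite weight_improper //= eqxx.
Qed.

End RangeColoring.

(** * Markers and the filling of gaps *)

Section ReturnTimes.
Context (q m : nat) (W : {set m.-tuple 'I_q}) (w : m.-tuple 'I_q).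
Implicit Types x y : int -> 'I_q.

Lemma eq_wordP x y i j :
  word m x i = word m y j <->
  forall l : 'I_m, x (i + l.+1%:Z) = y (j + l.+1%:Z).
Proof.
split => [E l|E].
  by have := congr1 (fun u => tnth u l) E; rewrite !tnth_mktuple.
by apply: eq_from_tnth => l; rewrite !tnth_mktuple.
Qed.

(** Two orbits that both show [w] can be glued there: a window of length [m]
    that crosses the joint still lies in one of the two orbits, since they agree
    on the [m] letters after the joint. *)
Lemma return_timesD s t : return_times W w s -> return_times W w t ->
  return_times W w (s + t)%N.
Proof.
move=> [s1 [x [Sx x0 xs]]] [t1 [y [Sy y0 yt]]].
split; first by rewrite addn_gt0 s1.
pose z i := if i <= s%:Z then x i else y (i - s%:Z).
have zx i : i <= s%:Z -> word m z i = word m x i.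
  move=> si; apply/eq_wordP => l; rewrite /z; case: ifPn => // h.
  have lm := ltn_ord l.
  have l'm : (`|(i + l.+1%:Z - s%:Z)%R|.-1 < m)%N by lia.
  have /eq_wordP/(_ (Ordinal l'm)) := etrans xs (esym y0).
  rewrite /= add0r => E.
  rewrite (_ : i + _ - _ = `|(i + l.+1%:Z - s%:Z)%R|.-1.+1%:Z); last by lia.
  by rewrite -E; congr x; lia.
have zy i : s%:Z <= i -> word m z i = word m y (i - s%:Z).
  move=> si; apply/eq_wordP => l; rewrite /z; case: ifPn => [h|_]; first by lia.
  by congr y; lia.
exists z; split.
- move=> i; have [si|/ltW si] := leP i s%:Z; first by rewrite zx //; exact: Sx.
  by rewrite zy //; exact: Sy.
- by rewrite zx //; lia.
- by rewrite zy ?PoszD; [rewrite addrAC subrr add0r|lia].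
Qed.

(** A numerical semigroup with gcd 1 contains all large integers: the least
    positive difference [d] of two elements divides every element, hence is 1;
    then combinations of the consecutive elements [b] and [b.+1] reach every
    integer from [b * b + b] on. *)
Lemma return_times_large :
  is_gcd (return_times W w) 1 ->
  exists N, forall t, (N <= t)%N -> return_times W w t.
Proof.
set T := return_times W w => -[_ T1].
have TM t k : (0 < k)%N -> T t -> T (k * t)%N.
  elim: k => [|[|k] IH] // _ Tt; first by rewrite mul1n.
  by rewrite mulSn; apply: return_timesD => //; exact: IH.
have [a Ta] : exists a, T a.
  apply: contrapT => nT; have : (2 %| 1)%N; last by [].
  by apply: T1 => t Tt; exfalso; apply: nT; exists t.
pose D d := `[< (0 < d)%N /\ exists2 b, T b & T (b + d)%N >].
have exD : exists d, D d.
  exists a; apply/asboolP; split; first by case: Ta.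
  by exists a => //; exact: return_timesD.
case: (ex_minnP exD) => d /asboolP[d0 [b Tb Tbd]] dmin.
have d1 : d = 1%N.
  apply/eqP; rewrite -dvdn1; apply: T1 => t Tt.
  rewrite /dvdn -[_ == _]negbK -lt0n; apply/negP => r0.
  have tE := divn_eq t d.
  set k := (t %/ d)%N in tE; set r := (t %% d)%N in tE r0.
  (* the remainder of [t] mod [d] would be a smaller positive difference *)
  have : (d <= r)%N; last by rewrite leqNgt /r ltn_mod d0.
  apply: dmin; apply/asboolP; split => //.
  exists ((k + 1) * (b + d))%N; first by apply: TM => //; rewrite addn1.
  have -> : ((k + 1) * (b + d) + r = t + ((k + 1) * b + d))%N by lia.
  apply: return_timesD => //.
  have -> : ((k + 1) * b + d = k * b + (b + d))%N by lia.
  have [->|k0] := posnP k; first by rewrite mul0n.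
  by apply: return_timesD => //; exact: TM.
rewrite {}d1 addn1 in Tbd; have b0 : (0 < b)%N by case: Tb.
exists (b * b + b)%N => t bt.
have tE := divn_eq t b; set k := (t %/ b)%N in tE; set r := (t %% b)%N in tE.
have rb : (r < b)%N by rewrite ltn_mod.
have -> : t = ((k - r) * b + r * b.+1)%N.
  have rk : (r <= k)%N by nia.
  by rewrite mulnBl mulnS; nia.
have : (0 < k - r)%N by nia.
have [->|r0 k0] := posnP r; first by rewrite mul0n addn0 => k0; exact: TM.
by apply: return_timesD; exact: TM.
Qed.

End ReturnTimes.

Definition shift (A : Type) (i : int) (c : int -> A) : int -> A :=
  fun j => c (i + j).

Section Markers.
Context (A : finType) (n : nat).
Implicit Types c : int -> A.

Definition range_colored c :=
  forall (i : int) (j : 'I_n), c i != c (i + j.+1%:Z).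

(** The greedy algorithm, one colour per round: in its round, a site is marked
    unless a site within distance [n] is already marked.  All sites of one
    colour can be treated at once because they are more than [n] apart in a
    range-[n] colouring. *)
Fixpoint mark t c (i : int) : bool :=
  if t is t'.+1 then
    mark t' c i || (enum_rank (c i) == t' :> nat) &&
      ~~ [exists j : 'I_n, mark t' c (i + j.+1%:Z) || mark t' c (i - j.+1%:Z)]
  else false.

Definition marked c i := mark #|A| c i.

Lemma mark_shift t c i j : mark t (shift i c) j = mark t c (i + j).
Proof.
elim: t j => //= t IH j; rewrite IH; congr (_ || _ && ~~ _).
by apply: eq_existsb => l; rewrite !IH !addrA.
Qed.

Lemma mark_local t c c' i :
  (forall d : int, (`|d| <= t * n)%N -> c (i + d) = c' (i + d)) ->
  mark t c i = mark t c' i.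
Proof.
elim: t i => //= t IH i cc'.
have E (d : int) : (`|d| <= n)%N -> mark t c (i + d) = mark t c' (i + d).
  by move=> dn; apply: IH => e et; rewrite -addrA; apply: cc'; lia.
congr (_ || _ && ~~ _).
- by have := E 0; rewrite addr0; apply.
- by have := cc' 0; rewrite addr0 => ->.
- apply: eq_existsb => l; have ln := ltn_ord l.
  by rewrite !E //; lia.
Qed.

Lemma mark_mono s t c i : (s <= t)%N -> mark s c i -> mark t c i.
Proof.
move=> /subnK <-; elim: (t - s)%N => [//|k IH /IH].
by rewrite addSn /= => ->.
Qed.

Lemma mark_separated t c i (j : 'I_n) : range_colored c ->
  mark t c i -> ~~ mark t c (i + j.+1%:Z).
Proof.
move=> cc; elim: t i => //= t IH i.
have [mi|nmi] /= := boolP (mark t c i).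
  move=> _; rewrite negb_or IH //= negb_and negbK; apply/orP; right.
  by apply/existsP; exists j; rewrite addrK mi orbT.
move=> /andP[/eqP ci /existsPn /(_ j)].
rewrite negb_or => /andP[/negbTE -> _] /=.
apply/negP => /andP[/eqP cj _]; have := cc i j.
by rewrite -(inj_eq enum_rank_inj) -val_eqE /= ci cj eqxx.
Qed.

(** In the round of its own colour, a site is either marked or blocked by an
    earlier mark nearby. *)
Lemma marked_dense c i : exists2 d : int, (`|d| <= n)%N & marked c (i + d).
Proof.
have lA := ltn_ord (enum_rank (c i)).
set t := enum_rank (c i) in lA.
have : mark t.+1 c i || [exists j : 'I_n,
    mark t c (i + j.+1%:Z) || mark t c (i - j.+1%:Z)].
  by rewrite /= eqxx; case: [exists _, _] => /=; rewrite !(orbT, orbF).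
move=> /orP[h|/existsP[j h]].
  by exists 0 => //; rewrite addr0; exact: mark_mono h.
have jn := ltn_ord j.
case/orP: h => h; [exists j.+1%:Z|exists (- j.+1%:Z)]; try lia.
  by apply: mark_mono h; exact: ltnW.
by apply: mark_mono h; exact: ltnW.
Qed.

(** Distances from site 0 to the last marker strictly before it and to the first
    marker at or after it.  By [marked_dense] a search among the [2n+1] nearest
    sites suffices, which keeps both local. *)
Definition backward c :=
  (find (fun d : nat => marked c (- d.+1%:Z)) (iota 0 n.*2.+1)).+1.
Definition forward c :=
  find (fun d : nat => marked c d%:Z) (iota 0 n.*2.+1).

Lemma find_iota (a : pred nat) N d : (d < N)%N -> a d ->
  (forall e, (e < d)%N -> ~~ a e) -> find a (iota 0 N) = d.
Proof.
move=> dN ad nad; apply/eqP; rewrite eqn_leq.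
apply/andP; split; rewrite leqNgt; apply/negP.
  by move=> /(before_find 0%N); rewrite nth_iota // add0n ad.
move=> h; have ha : has a (iota 0 N).
  by apply/hasP; exists d => //; rewrite mem_iota.
have := nth_find 0%N ha; rewrite nth_iota ?add0n; last exact: ltn_trans dN.
by apply/negP; exact: nad.
Qed.

Definition gap c j g := [/\ (0 < g)%N, marked c j, marked c (j + g%:Z)
  & forall t, (0 < t < g)%N -> ~~ marked c (j + t%:Z)].

Lemma gap_le c j g : gap c j g -> (g <= n.*2.+1)%N.
Proof.
move=> [_ _ _ ng]; rewrite leqNgt; apply/negP => gn.
have [d dn md] := marked_dense c (j + n.+1%:Z).
have /ng/negP[] : (0 < `|(n.+1%:Z + d)%R| < g)%N by lia.
by move: md; congr (marked c _); lia.
Qed.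

Lemma gap_gt c j g : range_colored c -> gap c j g -> (n < g)%N.
Proof.
move=> cc [g0 mj mg _]; rewrite ltnNge; apply/negP => gn.
have h : (g.-1 < n)%N by lia.
have := mark_separated (Ordinal h) cc mj.
by rewrite /= prednK // -/(marked _ _) mg.
Qed.

Lemma gap_after c j : marked c j -> exists g, gap c j g.
Proof.
move=> mj; have ex : exists g, (0 < g)%N && marked c (j + g%:Z).
  have [d dn md] := marked_dense c (j + n.+1%:Z).
  exists `|(n.+1%:Z + d)%R|%N; apply/andP; split; first by lia.
  by move: md; congr (marked c _); lia.
case: (ex_minnP ex) => g /andP[g0 mg] gmin.
exists g; split => // t /andP[t0 tg].
by apply/negP => mt; have := gmin t; rewrite t0 mt => /(_ isT); lia.
Qed.

Lemma gap_at c i : exists j g e, [/\ gap c j g, (e < g)%N & i = j + e%:Z].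
Proof.
have ex : exists d : nat, marked c (i - d%:Z).
  have [d dn md] := marked_dense c (i - n%:Z).
  exists `|(n%:Z - d)%R|%N; move: md; congr (marked c _); lia.
case: (ex_minnP ex) => e me emin.
have [g gj] := gap_after me; exists (i - e%:Z), g, e; split => //; last by lia.
rewrite ltnNge; apply/negP => ge; case: gj => g0 _ mg _.
have /emin : marked c (i - (e - g)%N%:Z) by move: mg; congr (marked c _); lia.
by lia.
Qed.

Lemma backwardE c j g d : gap c j g -> (0 < d <= g)%N ->
  backward (shift (j + d%:Z) c) = d.
Proof.
move=> gj /andP[d0 dg]; have gn := gap_le gj; case: gj => g0 mj mg ng.
rewrite /backward (@find_iota _ _ d.-1) ?prednK //; first by lia.
  by rewrite /marked mark_shift addrK.
move=> e ed; rewrite /marked mark_shift.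
have -> : j + d%:Z - e.+1%:Z = j + (d - e.+1)%N%:Z by lia.
by apply: ng; lia.
Qed.

Lemma forwardE c j g d : gap c j g -> (0 < d <= g)%N ->
  forward (shift (j + d%:Z) c) = (g - d)%N.
Proof.
move=> gj /andP[d0 dg]; have gn := gap_le gj; case: gj => g0 mj mg ng.
rewrite /forward (@find_iota _ _ (g - d)) //; first by lia.
  by rewrite /marked mark_shift; move: mg; congr (mark _ c _); lia.
move=> e ed; rewrite /marked mark_shift -addrA -PoszD.
by apply: ng; lia.
Qed.

Context (B : Type) (loop : nat -> int -> B).

Definition fill c := loop (backward c + forward c) (backward c)%:Z.

Lemma fillE c j g d : gap c j g -> (0 < d <= g)%N ->
  fill (shift (j + d%:Z) c) = loop g d%:Z.
Proof.
move=> gj dg; rewrite /fill (backwardE gj) // (forwardE gj) // subnKC //.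
by case/andP: dg.
Qed.

Definition fill_radius := (n.*2.+1 + #|A| * n)%N.

Lemma fill_local c c' :
  (forall d : int, (`|d| <= fill_radius)%N -> c d = c' d) -> fill c = fill c'.
Proof.
move=> cc'.
have E (d : int) : (`|d| <= n.*2.+1)%N -> marked c d = marked c' d.
  move=> dn; apply: mark_local => e et; apply: cc'; rewrite /fill_radius.
  by move: et; set k := (#|A| * n)%N; lia.
rewrite /fill.
have -> : backward c = backward c'.
  rewrite /backward; congr _.+1; apply: eq_in_find => d.
  by rewrite mem_iota /= => h; apply: E; lia.
have -> // : forward c = forward c'.
by apply: eq_in_find => d; rewrite mem_iota /= => h; apply: E; lia.
Qed.

End Markers.

(** The window starting after site [j + e], where [j] is the last marker up to
    that site, is read off [loop g]: letters beyond the next marker [j + g]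
    belong to another loop, but both loops show [w] there and the next gap is
    longer than the window. *)
Lemma fill_SFT (A : finType) n q m (W : {set m.-tuple 'I_q}) (w : m.-tuple 'I_q)
  (loop : nat -> int -> 'I_q) (c : int -> A) :
  (m <= n)%N ->
  (forall g, (n < g)%N ->
    [/\ SFT W (loop g), word m (loop g) 0 = w & word m (loop g) g%:Z = w]) ->
  range_colored n c -> SFT W (fun i => fill n loop (shift i c)).
Proof.
move=> mn lP cc i.
have [j [g [e [gj eg ->]]]] := gap_at n c i.
have gn := gap_gt cc gj.
have [Sg w0 wg] := lP g gn.
have [g' gj'] : exists g', gap n c (j + g%:Z) g' by apply: gap_after; case: gj.
have gn' := gap_gt cc gj'.
have [_ w0' _] := lP g' gn'.
have -> : word m (fun i => fill n loop (shift i c)) (j + e%:Z) =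
    word m (loop g) e%:Z.
  apply/eq_wordP => l; have lm := ltn_ord l; rewrite -addrA -!PoszD.
  have [elg|gel] := leqP (e + l.+1) g; first by rewrite (fillE _ gj) //; lia.
  have l'm : ((e + l.+1 - g).-1 < m)%N by lia.
  have -> : j + (e + l.+1)%N%:Z = j + g%:Z + (e + l.+1 - g)%N%:Z by lia.
  rewrite (fillE _ gj'); last by lia.
  have /eq_wordP/(_ (Ordinal l'm)) := etrans wg (esym w0').
  rewrite /= add0r prednK; last by lia.
  by move=> <-; congr (loop g); lia.
exact: Sg.
Qed.

(** * Coding words by nested intervals *)

Section Pick.
Context (R : realFieldType) (A : eqType) (a0 : A) (f : A -> R).
Context (f0 : forall a, 0 <= f a).

(** Inverse transform sampling: stacking intervals of length [f b], for [b]
    along [s], picks the letter whose interval contains [x]. *)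
Fixpoint pick_letter (s : seq A) (x : R) : A :=
  if s is b :: s' then if x < f b then b else pick_letter s' (x - f b) else a0.

Fixpoint mass_before (s : seq A) (a : A) : R :=
  if s is b :: s' then if a == b then 0 else f b + mass_before s' a else 0.

Lemma mass_before_ge0 s a : 0 <= mass_before s a.
Proof. by elim: s => //= b s IH; case: ifP => // _; rewrite addr_ge0. Qed.

Lemma mass_before_le s a : a \in s ->
  mass_before s a + f a <= \sum_(b <- s) f b.
Proof.
elim: s => //= b s IH; rewrite inE big_cons; case: eqP => [-> _|_ /= /IH h].
  by rewrite add0r lerDl sumr_ge0.
by rewrite -addrA lerD2l.
Qed.

Lemma pick_letter_mem s x :
  x < \sum_(b <- s) f b -> 0 <= x -> pick_letter s x \in s.
Proof.
elim: s x => [|b s IH] x /=; first by rewrite big_nil leNgt => ->.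
rewrite big_cons inE; case: (ltP x (f b)) => [_ _ _|h]; first by rewrite eqxx.
by rewrite -ltrBlDl => /IH h' x0; rewrite h' ?orbT // subr_ge0.
Qed.

Lemma pick_letterP s x a : uniq s -> a \in s -> 0 <= x ->
  x < \sum_(b <- s) f b ->
  (pick_letter s x == a) = (mass_before s a <= x < mass_before s a + f a).
Proof.
elim: s x => //= b s IH x /andP[bs us]; rewrite inE big_cons => as' x0 xs.
have [ab|ab] := eqVneq a b.
  rewrite ab add0r x0 /=; case: ltP => [_|h]; first exact: eqxx.
  apply: contraNF bs => /eqP <-.
  by apply: pick_letter_mem; [rewrite ltrBlDl|rewrite subr_ge0].
rewrite (negbTE ab) /= in as'; case: ltP => h.
  rewrite eq_sym (negbTE ab); apply/esym/negbTE; rewrite negb_and -ltNge.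
  by rewrite (lt_le_trans h) // lerDl mass_before_ge0.
rewrite IH // ?subr_ge0 ?ltrBlDl //.
by rewrite lerBrDl -addrA.
Qed.

End Pick.

Definition window (A : Type) (x : int -> A) (i : int) (n : nat) : seq A :=
  mkseq (fun j => x (i + j%:Z)) n.

Section Window.
Context (A : Type).
Implicit Types x : int -> A.

Lemma size_window x i n : size (window x i n) = n.
Proof. exact: size_mkseq. Qed.

Lemma nth_window a0 x i n j :
  (j < n)%N -> nth a0 (window x i n) j = x (i + j%:Z).
Proof. exact: nth_mkseq. Qed.

Lemma window_cat x i m n :
  window x i (m + n) = window x i m ++ window x (i + m%:Z) n.
Proof.
rewrite /window /mkseq iotaD map_cat add0n; congr (_ ++ _).
rewrite -[m in iota m n]addn0 iotaDl -map_comp; apply: eq_map => j /=.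
by rewrite PoszD addrA.
Qed.

Lemma subwindow x i j m n : i <= j -> j + n%:Z <= i + m%:Z ->
  window x j n = take n (drop `|j - i| (window x i m)).
Proof.
move=> ij jm; have -> : m = (`|j - i| + (n + (m - (`|j - i| + n))))%N by lia.
rewrite window_cat drop_size_cat ?size_window // window_cat.
rewrite take_size_cat ?size_window //; congr window; lia.
Qed.

End Window.

Section Coding.
Context (R : realFieldType) (A : finType) (a0 : A) (k : nat) (p : seq A -> R).
Context (lp : word_law k p).
Implicit Types (u v : seq A) (a : A) (o lo : R).

(** Words grow alternately on the two sides, so that the word of length [2N]
    occupies the sites [-N .. N-1] and every site is eventually reached. *)
Definition grow n u a := if odd n then a :: u else rcons u a.

(** The word of length [n] whose interval contains [o], and the left endpoint of
    this interval. *)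
Fixpoint state o n : seq A * R :=
  if n is n'.+1 then
    let u := (state o n').1 in
    let lo := (state o n').2 in
    let f a := p (grow n' u a) in
    let a := pick_letter a0 f (enum A) (o - lo) in
    (grow n' u a, lo + mass_before f (enum A) a)
  else ([::], 0).

Lemma size_grow n u a : size (grow n u a) = (size u).+1.
Proof. by rewrite /grow; case: ifP => // _; rewrite size_rcons. Qed.

Lemma grow_inj n u a v b : grow n u a = grow n v b -> u = v /\ a = b.
Proof.
by rewrite /grow; case: ifP => _; [case=> -> ->|move=> /rcons_inj[-> ->]].
Qed.

Lemma growP n u : size u = n.+1 -> exists v a, u = grow n v a /\ size v = n.
Proof.
rewrite /grow; case: (odd n).
  by case: u => // a u [su]; exists u, a.
by case/lastP: u => // u a; rewrite size_rcons => -[su]; exists u, a.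
Qed.

Lemma sum_grow n u : \sum_a p (grow n u a) = p u.
Proof.
by rewrite /grow; case: (odd n); [exact: (law_cons lp)|exact: (law_rcons lp)].
Qed.

Lemma size_state o n : size (state o n).1 = n.
Proof. by elim: n => //= n IH; rewrite size_grow IH. Qed.

(** The points coded by [u] form an interval of length [p u]: by consistency,
    the interval of a word is cut exactly into those of its extensions. *)
Lemma stateP n u : size u = n -> exists lo,
  [/\ 0 <= lo, lo + p u <= 1 & forall o, 0 <= o < 1 ->
    ((state o n).1 = u <-> lo <= o < lo + p u) /\
    ((state o n).1 = u -> (state o n).2 = lo)].
Proof.
elim: n u => [|n IH] u su.
  have -> : u = [::] by case: u su.
  exists 0; split => // [|o o1]; first by rewrite (law_nil lp) add0r.
  by rewrite (law_nil lp) add0r o1.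
have [v [a [-> /IH[lo [lo0 lo1 loP]]]]] := growP su.
pose f b := p (grow n v b).
have f0 b : 0 <= f b by exact: law_ge0 lp _.
have sf : \sum_(b <- enum A) f b = p v by rewrite big_enum; exact: sum_grow.
have mf := mass_before_le f0 (mem_enum A a : a \in enum A).
have m0 := mass_before_ge0 f0 (enum A) a.
exists (lo + mass_before f (enum A) a); split.
- exact: addr_ge0.
- by rewrite -addrA (le_trans _ lo1) // lerD2l -sf.
move=> o o1; have [sP s2] := loP o o1; rewrite /=.
split; last first.
  by move=> /grow_inj[sv]; rewrite sv (s2 sv) => ->.
split=> [/grow_inj[sv]|h].
  rewrite sv (s2 sv) -/f => /eqP; have /sP /andP[lo_o o_lo] := sv.
  rewrite pick_letterP ?enum_uniq ?mem_enum ?subr_ge0 ?sf ?ltrBlDl //.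
  by rewrite lerBrDl -addrA -[p _]/(f a).
have sv : (state o n).1 = v.
  apply/sP; case/andP: h => h1 h2; rewrite (le_trans _ h1) ?lerDl //=.
  by rewrite (lt_le_trans h2) // -addrA lerD2l -sf.
rewrite sv (s2 sv) -/f; congr grow; apply/eqP.
have /sP /andP[lo_o o_lo] := sv.
rewrite pick_letterP ?enum_uniq ?mem_enum ?subr_ge0 ?sf ?ltrBlDl //.
by rewrite lerBrDl addrA.
Qed.

Lemma state_double o n : exists a b,
  (state o n.+1.*2).1 = a :: rcons (state o n.*2).1 b.
Proof.
rewrite doubleS /= /grow /= odd_double /=.
by eexists; eexists.
Qed.

Lemma nth_state o m n j : (m <= n)%N -> (j < m.*2)%N ->
  nth a0 (state o n.*2).1 (j + (n - m)) = nth a0 (state o m.*2).1 j.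
Proof.
move=> /subnK <-; rewrite addnK; elim: (n - m)%N => [|d IH] jm.
  by rewrite addn0.
rewrite -IH // addSn; have [a [b ->]] := state_double o (d + m).
rewrite addnS /= nth_rcons size_state ifT //; rewrite doubleD; lia.
Qed.

(** Site [i] has been reached by the word of length [2 (|i| + 1)]. *)
Definition decode o (i : int) : A :=
  nth a0 (state o (`|i|.+1).*2).1 `|(i + `|i|.+1%:Z)%R|.

Lemma window_decode o n : window (decode o) (- n%:Z) n.*2 = (state o n.*2).1.
Proof.
apply: (@eq_from_nth _ a0); rewrite size_window ?size_state // => j jn.
rewrite nth_window // /decode; set i := - n%:Z + j%:Z.
have [mn|nm] := leqP `|i|.+1 n.
  rewrite -(nth_state _ mn); last by lia.
  by congr nth; lia.
rewrite -(nth_state o (ltnW nm)); last by lia.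
by congr nth; lia.
Qed.

End Coding.

(** * Realizing a family of weights as a process *)

Section UnitInterval.
Context (R : realType).

Definition unit_lebesgue : set (measurableTypeR R) -> \bar R :=
  mrestr (@lebesgue_measure R) (measurable_itv `[0, 1[).

HB.instance Definition _ := Measure.on unit_lebesgue.

Lemma unit_lebesgueT : unit_lebesgue setT = 1%E.
Proof.
rewrite /unit_lebesgue /mrestr setTI lebesgue_measure_itv /=.
by rewrite lte_fin ltr01 sube0.
Qed.

HB.instance Definition _ := Measure_isProbability.Build _ _ R
  unit_lebesgue unit_lebesgueT.

End UnitInterval.

Section WindowEvents.
Context (d : measure_display) (T : measurableType d) (R : realType).
Context (P : probability T R) (A : Type).
Implicit Types (Z : int -> T -> A) (G : pred (seq A)).

Definition window_event Z i n G : set T :=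
  [set o | G (window (Z^~ o) i n)].

(** Stationarity and [k]-dependence restricted to events that depend on finitely
    many consecutive sites. *)
Record window_process k Z : Prop := WindowProcess {
  wp_measurable : forall i n G, measurable (window_event Z i n G);
  wp_shift : forall i n G,
    P (window_event Z i n G) = P (window_event Z (i + 1) n G);
  wp_indep : forall i m n G H,
    P (window_event Z i m G `&` window_event Z (i + (m + k)%N%:Z) n H) =
    (P (window_event Z i m G) * P (window_event Z (i + (m + k)%N%:Z) n H))%E
}.

End WindowEvents.

Section Realization.
Context (R : realType) (A : finType) (a0 : A) (k : nat) (p : seq A -> R).
Context (lp : word_law k p).
Implicit Types (u v : seq A) (a : A) (o : R) (G H : pred (seq A)).

Let T := measurableTypeR R.
Let P : probability T R := @unit_lebesgue R.

(** Points outside the unit interval form a null set; sending them to 0 makes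
    the properties of the coding hold everywhere. *)
Definition clamp o : R := if 0 <= o < 1 then o else 0.

Lemma clamp01 o : 0 <= clamp o < 1.
Proof. by rewrite /clamp; case: ifP => // _; rewrite lexx ltr01. Qed.

Definition coordinate (i : int) (o : T) : A := decode a0 p (clamp o) i.

Definition state_event n u : set T :=
  [set o : T | (state a0 p (clamp o) n).1 = u].

Lemma state_eventP n u : size u = n ->
  measurable (state_event n u) /\ P (state_event n u) = (p u)%:E.
Proof.
move=> su; have [lo [lo0 lo1 loP]] := stateP a0 lp su.
have E : state_event n u `&` `[0, 1[%classic = `[lo, lo + p u[%classic.
  apply/seteqP; split=> o /=; rewrite !in_itv /=.
    move=> [h o1]; have [sP _] := loP _ (clamp01 o).
    by have /sP := h; rewrite /clamp o1.
  move=> h; have o1 : 0 <= o < 1.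
    by case/andP: h => h1 h2; rewrite (le_trans lo0) //= (lt_le_trans h2).
  split => //; have [sP _] := loP _ o1.
  by rewrite /state_event /= /clamp o1; apply/sP.
split; last first.
  rewrite /P /= /unit_lebesgue /mrestr E lebesgue_measure_itv /= lte_fin.
  have := law_ge0 lp u; rewrite le_eqVlt => /predU1P[<-|pu].
    by rewrite addr0 ltxx.
  by rewrite ltrDl pu -EFinD addrAC subrr add0r.
rewrite -[state_event n u](setIT) -(setUv `[0, 1[%classic) setIUr E.
apply: measurableU; first exact: measurable_itv.
(* 2 stands for any point outside the unit interval *)
have [h|h] := pselect (state_event n u 2).
  rewrite setIidr; first by apply: measurableC; exact: measurable_itv.
  move=> o /= o1; move: h; rewrite /state_event /= /clamp.
  rewrite ifF; last by rewrite ltNge ler1n andbF.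
  by rewrite ifF //; apply/negP; move: o1; rewrite in_itv.
rewrite (_ : _ `&` _ = set0); first exact: measurable0.
apply/seteqP; split => // o /= [ho o1]; apply: h; move: ho.
rewrite /state_event /= /clamp (@ifF _ (0 <= 2 < 1)); last first.
  by rewrite ltNge ler1n andbF.
by rewrite ifF //; apply/negP; move: o1; rewrite in_itv.
Qed.

Lemma full_window_prob n G :
  measurable (window_event coordinate (- n%:Z) n.*2 G) /\
  P (window_event coordinate (- n%:Z) n.*2 G) =
  (sum_words n.*2 (fun u => (G u)%:R * p u))%:E.
Proof.
have E : window_event coordinate (- n%:Z) n.*2 G =
   \bigcup_(t in [set t : n.*2.-tuple A | G t]) state_event n.*2 t.
  apply/seteqP; split => o; rewrite /window_event /= window_decode.
    move=> Go; have so : size (state a0 p (clamp o) n.*2).1 == n.*2.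
      by rewrite size_state.
    by exists (Tuple so).
  by move=> [t Gt h]; rewrite [_.1]h.
have mE t : measurable (state_event n.*2 (t : n.*2.-tuple A)).
  by have [] := state_eventP (size_tuple t).
rewrite E; split; first exact: fin_bigcup_measurable.
rewrite measure_fin_bigcup //; last 2 first.
- exact: finite_finset.
- move=> t t' _ _ [o [/= h h']]; apply: val_inj.
  exact: etrans (esym h) h'.
rewrite sum_wordsE.
rewrite (fsbigE (seq.filter (fun t : n.*2.-tuple A => G t)
  (enum {: n.*2.-tuple A}))); last 3 first.
- by rewrite filter_uniq ?enum_uniq.
- by move=> t /=; rewrite mem_filter => /andP[].
- by move=> t /= Gt; rewrite mem_filter Gt mem_enum.
rewrite big_filter_cond big_enum_cond /= -sumEFin big_mkcond.
apply: eq_bigr => t _.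
have [_ ->] := state_eventP (size_tuple t).
case: ifPn => [/andP[->]|]; first by rewrite mul1r.
case: (boolP (G t)) => [Gt|_]; last by rewrite mul0r.
by rewrite mem_set.
Qed.

Lemma enclosing_window i n : exists N l r, N.*2 = (l + (n + r))%N /\
  forall x : int -> A, window x (- N%:Z) N.*2 =
    window x (- N%:Z) l ++ window x i n ++ window x (i + n%:Z) r.
Proof.
exists (`|i| + n)%N, `|(i + (`|i| + n)%N%:Z)%R|%N, `|((`|i|)%N%:Z - i)%R|%N.
split; first by lia.
set N := (`|i| + n)%N; move=> x.
have -> : N.*2 = (`|(i + N%:Z)%R| + (n + `|((`|i|)%N%:Z - i)%R|))%N by lia.
rewrite !window_cat; congr (_ ++ (window x _ _ ++ window x _ _)); lia.
Qed.

Lemma window_prob i n G :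
  measurable (window_event coordinate i n G) /\
  P (window_event coordinate i n G) =
  (sum_words n (fun u => (G u)%:R * p u))%:E.
Proof.
have [N [l [r [NE NW]]]] := enclosing_window i n.
have [mE PE] := full_window_prob N (fun u => G (take n (drop l u))).
have -> : window_event coordinate i n G =
    window_event coordinate (- N%:Z) N.*2 (fun u => G (take n (drop l u))).
  rewrite /window_event; apply/funext => o /=.
  by rewrite NW drop_size_cat ?take_size_cat ?size_window.
split => //; rewrite PE NE sum_words_cat; congr _%:E.
have E x : size x = l -> sum_words (n + r) (fun y =>
    (G (take n (drop l (x ++ y))))%:R * p (x ++ y)) =
    sum_words n (fun u => (G u)%:R * p (x ++ u)).
  move=> sx; rewrite sum_words_cat; apply: eq_sum_words => u su.
  rewrite -(law_sum_right lp r) -sum_words_mull; apply: eq_sum_words => v _.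
  by rewrite -catA drop_size_cat // take_size_cat.
rewrite (eq_sum_words E) exchange_sum_words; apply: eq_sum_words => u su.
by rewrite sum_words_mull (law_sum_left lp).
Qed.

(** A point of the half-open interval of a word witnesses that its length is
    positive, so null words occur nowhere. *)
Lemma window_weight_neq0 i n o : p (window (coordinate^~ o) i n) != 0.
Proof.
have [N [l [r [NE NW]]]] := enclosing_window i n.
have [lo [_ _ loP]] := stateP a0 lp (size_state a0 p (clamp o) N.*2).
have [[/(_ erefl) h _] _] := loP _ (clamp01 o).
have : p (window (coordinate^~ o) (- N%:Z) N.*2) != 0.
  rewrite window_decode; apply: contraTneq h => ->.
  by rewrite addr0; apply/negP => /andP[/le_lt_trans h1 /h1]; rewrite ltxx.
rewrite NW; apply: contra_neq => h0; exact: (law_infix lp).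
Qed.

Lemma coordinate_process : window_process P k coordinate.
Proof.
split.
- by move=> i n G; have [] := window_prob i n G.
- by move=> i n G; rewrite !(window_prob _ n G).2.
move=> i m n G H.
have -> : window_event coordinate i m G `&`
    window_event coordinate (i + (m + k)%N%:Z) n H =
    window_event coordinate i (m + (k + n))%N
      (fun u => G (take m u) && H (drop (k + m) u)).
  rewrite /window_event; apply/funext => o /=; rewrite window_cat.
  rewrite take_size_cat ?size_window // -drop_drop.
  rewrite drop_size_cat ?size_window //.
  rewrite window_cat drop_size_cat ?size_window // PoszD addrA.
  by apply/propext; split=> [[-> ->]|/andP[]].
rewrite !(window_prob _ _ _).2 -EFinM; congr _%:E.
rewrite sum_words_cat -sum_words_mulr; apply: eq_sum_words => u su.
rewrite sum_words_cat exchange_sum_words -sum_words_mull.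
apply: eq_sum_words => v sv; rewrite mulrACA -(law_indep lp) -sum_words_mull.
apply: eq_sum_words => w sw; rewrite take_size_cat //.
by rewrite -drop_drop drop_size_cat // drop_size_cat // -mulnb natrM.
Qed.

End Realization.

(** * Block factors and generated sigma-algebras *)

Section BlockFactor.
Context (d : measure_display) (T : measurableType d) (R : realType).
Context (P : probability T R) (A B : Type) (a0 : A) (r : nat).
Context (F : (int -> A) -> B).
Context (F_local : forall x y,
  (forall j : int, (`|j| <= r)%N -> x j = y j) -> F x = F y).

Definition block_factor (Z : int -> T -> A) (i : int) (o : T) : B :=
  F (shift i (Z^~ o)).

(** The factor map on words; outside of the [r]-neighbourhood of a site the
    configuration is padded with junk, which [F] does not see. *)
Definition factor_word n (u : seq A) : seq B :=
  mkseq (fun j => F (fun e => nth a0 u `|(e + (r + j)%N%:Z)%R|)) n.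

Lemma window_block_factor Z o i n :
  window ((block_factor Z)^~ o) i n =
  factor_word n (window (Z^~ o) (i - r%:Z) (n + r.*2)).
Proof.
apply: (@eq_from_nth _ (F (fun=> a0)));
  rewrite size_window ?size_mkseq // => j jn.
rewrite nth_window // nth_mkseq //; apply: F_local => e er.
by rewrite nth_window; [congr (Z _ o); lia|lia].
Qed.

Lemma window_event_block_factor Z i n G :
  window_event (block_factor Z) i n G =
  window_event Z (i - r%:Z) (n + r.*2) (fun u => G (factor_word n u)).
Proof.
by rewrite /window_event; apply/funext => o /=; rewrite window_block_factor.
Qed.

Lemma block_factor_process k Z :
  window_process P k Z -> window_process P (k + r.*2) (block_factor Z).
Proof.
move=> [mZ sZ iZ]; split.
- by move=> i n G; rewrite window_event_block_factor.
- by move=> i n G; rewrite !window_event_block_factor sZ addrAC.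
- move=> i m n G H; rewrite !window_event_block_factor.
  have -> : i + (m + (k + r.*2))%N%:Z - r%:Z =
    i - r%:Z + (m + r.*2 + k)%N%:Z by lia.
  exact: iZ.
Qed.

End BlockFactor.

Section PiLambda.
Context (d : measure_display) (T : measurableType d) (R : realType).
Context (P : probability T R).

(** For fixed [B], the measures [P (_ `&` B)] and [P B * P _] agree on a
    pi-system, hence on what it generates. *)
Lemma indep_sigma_left (G : set (set T)) (B : set T) :
  setI_closed G -> G setT -> G `<=` measurable -> measurable B ->
  (forall A, G A -> P (A `&` B) = (P A * P B)%E) ->
  forall A, <<s G >> A -> P (A `&` B) = (P A * P B)%E.
Proof.
move=> GI GT Gm mB GB A sA.
have PB0 : 0 <= fine (P B) by rewrite fine_ge0.
have PBE : (NngNum PB0)%:num%:E = P B by rewrite /= fineK // fin_num_measure.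
have := @g_sigma_algebra_measure_unique _ R T G Gm (fun=> setT) (fun=> GT) _
  (mrestr P mB) (mscale (NngNum PB0) P) GI _ _ A sA.
rewrite /= /mrestr /mscale PBE muleC; apply.
- by rewrite bigcup_const //; exists 0%N.
- by move=> E GE; rewrite GB // muleC.
- move=> _; rewrite setTI.
  by rewrite ltey_eq fin_num_measure.
Qed.

Lemma indep_sigma (G H : set (set T)) :
  setI_closed G -> G setT -> G `<=` measurable ->
  setI_closed H -> H setT -> H `<=` measurable ->
  (forall A B, G A -> H B -> P (A `&` B) = (P A * P B)%E) ->
  forall A B, <<s G >> A -> <<s H >> B -> P (A `&` B) = (P A * P B)%E.
Proof.
move=> GI GT Gm HI HT Hm GH A B sA sB.
have mB : measurable B.
  by apply: (smallest_sub (@sigma_algebra_measurable _ T) Hm).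
apply: (indep_sigma_left GI GT Gm mB) => // {A sA} A GA.
rewrite setIC muleC; apply: (indep_sigma_left HI HT Hm) => //; first exact: Gm.
by move=> E HE; rewrite setIC muleC; exact: GH.
Qed.

Lemma same_law_sigma (S : Type) (f g : T -> S) (G : set (set S)) :
  setI_closed G ->
  (forall B, G B -> [/\ measurable (f @^-1` B), measurable (g @^-1` B) &
    P (f @^-1` B) = P (g @^-1` B)]) ->
  forall B, <<s G >> B -> P (f @^-1` B) = P (g @^-1` B).
Proof.
move=> GI fg B sB.
suff : [set B | [/\ measurable (f @^-1` B), measurable (g @^-1` B) &
    P (f @^-1` B) = P (g @^-1` B)]] B by case.
move: B sB; apply: lambda_system_subset => //.
apply/dynkin_lambda_system; split.
- by split; rewrite ?preimage_setT.
- move=> C [mf mg E].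
  rewrite /= -[f @^-1` _]/(~` (f @^-1` C)) -[g @^-1` _]/(~` (g @^-1` C)).
  by split; [exact: measurableC|exact: measurableC|];
    rewrite !probability_setC // E.
- move=> F tF FE; rewrite /= (preimage_bigcup _ f) (preimage_bigcup _ g).
  have t h : trivIset setT (fun n => h @^-1` F n : set T).
    by move=> i j _ _ [o [/= h1 h2]]; apply: tF => //; exists (h o).
  split; try by apply: bigcup_measurable => n _; have [] := FE n.
  rewrite !measure_bigcup //; try by move=> n _; have [] := FE n.
  by congr (limn _); apply/funext => n; apply: eq_bigr => i _; have [] := FE i.
Qed.

End PiLambda.

Section Processes.
Context (d : measure_display) (T : measurableType d) (R : realType).
Context (P : probability T R) (q k : nat) (X : int -> T -> 'I_q).
Context (Xwp : window_process P k X).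

Definition first_letter (E : set 'I_q) (u : seq 'I_q) : bool :=
  if u is a :: _ then `[< E a >] else false.

Lemma preimage_window_event i E n :
  X i @^-1` E = window_event X i n.+1 (first_letter E).
Proof.
apply/seteqP; rewrite /window_event; split => o /=.
  by rewrite addr0 => h; apply/asboolP.
by rewrite addr0 => /asboolP.
Qed.

Lemma window_process_is_process : is_process X.
Proof.
move=> i E; rewrite (preimage_window_event i E 0).
exact: wp_measurable Xwp _ _ _.
Qed.

Lemma sub_window_event i j m n G : i <= j -> j + n%:Z <= i + m%:Z ->
  window_event X j n G =
  window_event X i m (fun u => G (take n (drop `|j - i| u))).
Proof.
by move=> ij jm; rewrite /window_event; apply/funext => o /=;
  rewrite -subwindow.
Qed.

Lemma window_eventI i n G H :
  window_event X i n G `&` window_event X i n H =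
  window_event X i n (fun u => G u && H u).
Proof.
rewrite /window_event; apply/funext => o /=.
by apply/propext; split=> [[-> ->]|/andP[]].
Qed.

(** Events that depend on finitely many sites before [i], enlarged to a window
    that ends at [i], which makes them closed under intersection. *)
Definition past_events i : set (set T) :=
  [set E | exists n G, E = window_event X (i - n%:Z) n G].

Definition future_events i : set (set T) :=
  [set E | exists n G, E = window_event X i n G].

Lemma past_eventsI i : setI_closed (past_events i).
Proof.
move=> _ _ [m [G ->]] [n [H ->]]; exists (maxn m n).
rewrite (@sub_window_event (i - (maxn m n)%:Z) (i - m%:Z) (maxn m n));
  [|lia|lia].
rewrite (@sub_window_event (i - (maxn m n)%:Z) (i - n%:Z) (maxn m n));
  [|lia|lia].
by rewrite window_eventI; eexists.
Qed.

Lemma future_eventsI i : setI_closed (future_events i).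
Proof.
move=> _ _ [m [G ->]] [n [H ->]]; exists (maxn m n).
rewrite (@sub_window_event i i (maxn m n) m); [|lia|lia].
rewrite (@sub_window_event i i (maxn m n) n); [|lia|lia].
by rewrite window_eventI; eexists.
Qed.

Lemma window_process_k_dependent : k_dependent P k X.
Proof.
move=> i A B sA sB.
apply: (@indep_sigma _ _ _ P (past_events i) (future_events (i + k%:Z))).
- exact: past_eventsI.
- by exists 0%N, (fun=> true); apply/seteqP; split.
- by move=> _ [n [G ->]]; exact: wp_measurable Xwp _ _ _.
- exact: future_eventsI.
- by exists 0%N, (fun=> true); apply/seteqP; split.
- by move=> _ [n [G ->]]; exact: wp_measurable Xwp _ _ _.
- move=> _ _ [m [G ->]] [n [H ->]].
  have -> : i + k%:Z = i - m%:Z + (m + k)%N%:Z by lia.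
  exact: wp_indep Xwp _ _ _ _ _.
- move: A sA; apply: sub_smallest2r; first exact: smallest_sigma_algebra.
  move=> _ [j /= ji [E _ <-]]; rewrite setTI.
  exists `|i - j|%N; exists (first_letter E).
  have h : (0 < `|i - j|)%N by lia.
  have -> : i - `|i - j|%N%:Z = j by lia.
  by rewrite -(prednK h) -preimage_window_event.
- move: B sB; apply: sub_smallest2r; first exact: smallest_sigma_algebra.
  move=> _ [j /= ji [E _ <-]]; rewrite setTI (preimage_window_event j E 0).
  exists `|(j - (i + k%:Z))%R|%N.+1, (fun u =>
    first_letter E (take 1 (drop `|(j - (i + k%:Z))%R|%N u))).
  by apply: sub_window_event; lia.
Qed.

Definition cylinders : set (set (int -> 'I_q)) :=
  [set B | exists n (G : pred (seq 'I_q)),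
     B = [set x | G (window x (- n%:Z) n.*2)]].

Lemma window_process_stationary : stationary P X.
Proof.
move=> B sB.
apply: (@same_law_sigma _ _ _ P _ (fun o => X^~ o)
  (fun o i => X (i + 1) o) cylinders).
- move=> _ _ [m [G ->]] [n [H ->]]; exists (maxn m n).
  exists (fun u => G (take m.*2 (drop `|- m%:Z - - (maxn m n)%:Z| u)) &&
                   H (take n.*2 (drop `|- n%:Z - - (maxn m n)%:Z| u))).
  apply/funext => x /=.
  rewrite -!subwindow; try lia.
  by apply/propext; split=> [[-> ->]|/andP[]].
- move=> _ [n [G ->]].
  have E1 : (fun o => X^~ o) @^-1` [set x | G (window x (- n%:Z) n.*2)] =
    window_event X (- n%:Z) n.*2 G by [].
  have E2 :
      (fun o i => X (i + 1) o) @^-1` [set x | G (window x (- n%:Z) n.*2)] =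
      window_event X (- n%:Z + 1) n.*2 G.
    rewrite /window_event; apply/funext => o /=; congr (is_true (G _)).
    by apply: eq_mkseq => j /=; rewrite addrAC.
  rewrite E1 E2; split; [| |exact: wp_shift Xwp _ _ _];
    exact: wp_measurable Xwp _ _ _.
- move: B sB; apply: sub_smallest2r; first exact: smallest_sigma_algebra.
  move=> _ [j _ [E _ <-]]; rewrite setTI.
  exists `|j|.+1, (fun u =>
    first_letter E (take 1 (drop `|j - - (`|j|.+1)%:Z| u))).
  apply/funext => x /=; rewrite -subwindow; try lia.
  rewrite /= addr0; apply/propext; split => [h|/asboolP//].
  exact/asboolP.
Qed.

End Processes.

Theorem corollary6 (R : realType) (q m : nat) (W : {set m.-tuple 'I_q})
    (hq : (0 < q)%N) (hm : (0 < m)%N) (hW : non_lattice W) :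
  exists (k : nat) (d : measure_display) (T : measurableType d)
    (P : probability T R) (X : int -> T -> 'I_q),
    [/\ is_process X, stationary P X, k_dependent P k X
      & {ae P, forall o : T, SFT W (fun i : int => X i o)}].
Proof.
have [w _ /return_times_large[N wN]] := hW.
pose n := maxn N m.
pose A := {ffun 'I_n -> 'I_4}.
have a0 : A := [ffun=> ord0].
have loopP g : exists x : int -> 'I_q, (n < g)%N ->
    [/\ SFT W x, word m x 0 = w & word m x g%:Z = w].
  have [ng|ng] := boolP (n < g)%N; last by exists (fun=> Ordinal hq).
  have [|_ [x xP]] := wN g; last by exists x.
  by apply: leq_trans (ltnW ng); exact: leq_maxl.
have [loop {}loopP] := choice loopP.
pose p := @range_weight R n.
have lp : word_law n p := range_law R n.
pose Z := coordinate a0 p.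
have Zwp := coordinate_process a0 lp.
have X_local := @fill_local A n _ loop.
pose X := block_factor (fill n loop) Z.
have Xwp := block_factor_process a0 X_local Zwp.
exists (n + (fill_radius A n).*2)%N, _, _, (@unit_lebesgue R), X; split.
- exact: window_process_is_process Xwp.
- exact: window_process_stationary Xwp.
- exact: window_process_k_dependent Xwp.
apply: aeW => o; apply: (fill_SFT (w := w)); first exact: leq_maxr.
  exact: loopP.
move=> i j; apply/negP => /eqP E.
(* equal letters at sites [i] and [i + j + 1] make a null word *)
have EW : window (Z^~ o) i (1 + (j + 1)) =
    [::] ++ Z i o :: window (Z^~ o) (i + 1) j ++ Z i o :: [::].
  rewrite !window_cat /= {1}/window /= addr0; congr (_ :: _ ++ _).
  rewrite /window /= [X in _ = [:: X]]E; congr [:: Z _ o]; lia.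
have := window_weight_neq0 a0 lp i (1 + (j + 1)) o.
by rewrite -/Z EW /p (@range_weight_eq0 R n) ?eqxx ?size_window.
Qed.
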